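(* For every integer $n\ge -1$, one has $q_n(x)=C_n^{(-1/2)}(x;3/2)$; that is, the polynomials $q_n=P_{-4,2n}$ are the associated ultraspherical polynomials with parameters $\nu=-1/2$ and $c=3/2$.
   Context: The polynomials $P_{-4,k}(x)$, $k\ge -4$, are defined by $P_{-4,-4}=1$, $P_{-4,-3}=P_{-4,-2}=P_{-4,-1}=0$ and $$(6+2k)P_{-4,k}(x)=4k\,x\,P_{-4,k-2}(x)-2(k-3)P_{-4,k-4}(x),\qquad k\ge 0.$$ All odd-indexed ones vanish. Set $q_n(x)=P_{-4,2n}(x)$ for $n\ge -2$; so $q_{-2}=1$, $q_{-1}=0$, $q_0=1$, $q_1=\frac{4x}{5}$, $q_2=\frac{32x^2-5}{35}$. For complex constants $c,\nu$, the associated ultraspherical polynomials $C_n^{(\nu)}(x;c)$ are defined by $C_{-1}^{(\nu)}(x;c)=0$, $C_0^{(\nu)}(x;c)=1$ and, for $n\ge 0$, $$2x(n+\nu+c)C_n^{(\nu)}(x;c)=(n+c+1)C_{n+1}^{(\nu)}(x;c)+(2\nu+n+c-1)C_{n-1}^{(\nu)}(x;c).$$ *)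

(* Defs.v *)
From HB Require Import structures.
From mathcomp Require Import all_boot all_order all_algebra.
From mathcomp Require Import reals complex.

Set Implicit Arguments.
Unset Strict Implicit.
Unset Printing Implicit Defensive.

Import Order.TTheory GRing.Theory Num.Theory.
Local Open Scope ring_scope.

(* Pm4_shift K m is the polynomial of index k = m - 4; in the last branch
   m = k + 4, so the bound variable k is the mathematical index itself. *)
Fixpoint Pm4_shift (K : fieldType) (m : nat) : {poly K} :=
  match m with
  | 0 => 1
  | 1 | 2 | 3 => 0
  | ((k.+2) as k2).+2 =>
      (6 + 2 * k%:R)^-1 *:
        ((4 * k%:R) *: ('X * Pm4_shift K k2)
         - (2 * (k%:R - 3)) *: Pm4_shift K k)
  end.

(* P_{-4,k}; the value 0 for k < -4 is a junk value. *)
Definition Pm4 (K : fieldType) (k : int) : {poly K} :=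
  if k + 4 is Posz m then Pm4_shift K m else 0.

Definition q (K : fieldType) (n : int) : {poly K} := Pm4 K (2 * n).

(* assoc_ultra_shift nu c m is the polynomial of index m - 1; in the last
   branch m = n + 2, and the recurrence is solved for the index n + 1.
   This requires n + c + 1 != 0 for all n : nat; see assoc_ultra_rec. *)
Fixpoint assoc_ultra_shift (K : fieldType) (nu c : K) (m : nat) : {poly K} :=
  match m with
  | 0 => 0
  | 1 => 1
  | (n.+1 as n1).+1 =>
      (n%:R + c + 1)^-1 *:
        ((2 * (n%:R + nu + c)) *: ('X * assoc_ultra_shift nu c n1)
         - (2 * nu + n%:R + c - 1) *: assoc_ultra_shift nu c n)
  end.

(* C_n^{(nu)}(x; c); the value 0 for n < -1 is a junk value. *)
Definition assoc_ultra (K : fieldType) (nu c : K) (n : int) : {poly K} :=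
  if n + 1 is Posz m then assoc_ultra_shift nu c m else 0.

Lemma Pm4_init (K : fieldType) :
  [/\ Pm4 K (-4) = 1, Pm4 K (-3) = 0, Pm4 K (-2) = 0 & Pm4 K (-1) = 0].
Proof. by []. Qed.

Lemma Pm4_rec (K : numFieldType) (k : int) : 0 <= k ->
  (6 + 2 * k%:~R) *: Pm4 K k
  = (4 * k%:~R) *: ('X * Pm4 K (k - 2))
    - (2 * (k%:~R - 3)) *: Pm4 K (k - 4).
Proof.
case: k => // k _; rewrite /Pm4.
have -> : Posz k + 4 = Posz k.+4 by rewrite -PoszD addn4.
have -> : Posz k - 2 + 4 = Posz k.+2 by rewrite -addrA -PoszD addn2.
have -> : Posz k - 4 + 4 = Posz k by rewrite subrK.
rewrite [Pm4_shift K k.+4]/= scalerA divff ?scale1r //.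
by rewrite -natrM -natrD pnatr_eq0.
Qed.

Lemma assoc_ultra_init (K : fieldType) (nu c : K) :
  assoc_ultra nu c (-1) = 0 /\ assoc_ultra nu c 0 = 1.
Proof. by []. Qed.

Lemma assoc_ultra_rec (K : fieldType) (nu c : K) (n : int) :
  0 <= n -> n%:~R + c + 1 != 0 ->
  (2 * (n%:~R + nu + c)) *: ('X * assoc_ultra nu c n)
  = (n%:~R + c + 1) *: assoc_ultra nu c (n + 1)
    + (2 * nu + n%:~R + c - 1) *: assoc_ultra nu c (n - 1).
Proof.
case: n => // n _ nz; rewrite /assoc_ultra.
have -> : Posz n + 1 + 1 = Posz n.+2 by rewrite -!PoszD !addn1.
have -> : Posz n + 1 = Posz n.+1 by rewrite -PoszD addn1.
have -> : Posz n - 1 + 1 = Posz n by rewrite subrK.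
by rewrite [assoc_ultra_shift nu c n.+2]/= scalerA divff // scale1r subrK.
Qed.

(* Main.v *)
Require Import Defs.
From HB Require Import structures.
From mathcomp Require Import all_boot all_order all_algebra.
From mathcomp Require Import reals complex.
From mathcomp Require Import ring.

Set Implicit Arguments.
Unset Strict Implicit.
Unset Printing Implicit Defensive.

Import Order.TTheory GRing.Theory Num.Theory.
Local Open Scope ring_scope.

(** Restricted to even indices k = 2 n + 2, the recurrence of P_{-4,k} reads
      (4 n + 10) q_{n+1} = 8 (n + 1) x q_n - (4 n - 2) q_{n-1},
    which is 4 times the recurrence of the associated ultraspherical
    polynomials at nu = -1/2, c = 3/2, namely
      (n + 5/2) C_{n+1} = 2 (n + 1) x C_n - (n - 1/2) C_{n-1}.
    Both sequences start with the values 0, 1 at the indices -1, 0, so they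
    coincide; lemma [Pm4_shift_even] is this two-step induction. *)

Lemma Pm4_shiftSSSS (K : fieldType) (k : nat) :
  Pm4_shift K k.+4 =
  (6 + 2 * k%:R)^-1 *:
    ((4 * k%:R) *: ('X * Pm4_shift K k.+2) - (2 * (k%:R - 3)) *: Pm4_shift K k).
Proof. by []. Qed.

Lemma assoc_ultra_shiftSS (K : fieldType) (nu c : K) (n : nat) :
  assoc_ultra_shift nu c n.+2 =
  (n%:R + c + 1)^-1 *:
    ((2 * (n%:R + nu + c)) *: ('X * assoc_ultra_shift nu c n.+1)
     - (2 * nu + n%:R + c - 1) *: assoc_ultra_shift nu c n).
Proof. by []. Qed.

(** The index m on the ultraspherical side stands for n = m - 1, to which
    corresponds the shifted index 2 n + 4 = 2 m + 2 on the other side. *)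
Lemma Pm4_shift_even (K : numFieldType) (m : nat) :
  Pm4_shift K m.*2.+2 = assoc_ultra_shift (- (1 / 2)) (3 / 2) m.
Proof.
suff [] : Pm4_shift K m.*2.+2 = assoc_ultra_shift (- (1 / 2)) (3 / 2) m
  /\ Pm4_shift K m.+1.*2.+2 = assoc_ultra_shift (- (1 / 2)) (3 / 2) m.+1 by [].
elim: m => [|n [IHn IHn1]].
  (* At k = 0 the recurrence gives 6 P_{-4,0} = 6 P_{-4,-4} = 6. *)
  split=> //; rewrite (Pm4_shiftSSSS K 0) !mulr0 scale0r !add0r addr0 /=.
  by rewrite -scaleNr scalerA -[RHS]scale1r; congr (_ *: _); field.
split=> //; rewrite assoc_ultra_shiftSS -IHn -IHn1 !doubleS Pm4_shiftSSSS.
have -> : n.*2.+2%:R = 2 * n%:R + 2 :> K by rewrite -natrM -natrD mul2n addn2.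
rewrite !scalerBr !scalerA.
(* Twice the denominator n + 3/2 + 1, and the denominator 6 + 2 k at
   k = 2 n + 2, are both nonzero in characteristic zero. *)
have nz5 : n%:R * 2 + 3 + 2 != 0 :> K.
  by rewrite -natrM -!natrD addnS pnatr_eq0.
have nz10 : 6 + 2 * (2 * n%:R + 2) != 0 :> K.
  by rewrite -natrM -natrD -natrM -natrD addSn pnatr_eq0.
by congr (_ *: _ - _ *: _); field; rewrite nz5 nz10.
Qed.

Theorem mainTheorem3 (R : realType) (n : int) (hn : -1 <= n) :
  q R[i] n = assoc_ultra (- (1 / 2) : R[i]) (3 / 2 : R[i]) n.
Proof.
have [m def_m] : exists m : nat, n + 1 = m.
  by exists (absz (n + 1)); rewrite gez0_abs // -lerBlDr sub0r.
have def_2m : 2 * n + 4 = m.*2.+2.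
  have -> : m.*2.+2 = (2 * m + 2)%N by rewrite mul2n addn2.
  by rewrite PoszD PoszM -def_m; ring.
by rewrite /q /Pm4 /assoc_ultra def_m def_2m Pm4_shift_even.
Qed.
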